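(* Consider the multi-ion GLM-MHD system for $\mathbf u=(\rho_k,\rho_k\vec v_k,E_k,\vec B,\psi)_{k=1,\dots,N_i}$: for $k=1,\dots,N_i$, $$\partial_t\rho_k+\nabla\cdot(\rho_k\vec v_k)=0,$$ $$\partial_t(\rho_k\vec v_k)+\nabla\cdot(\rho_k\vec v_k\vec v_k^{\,T}+p_kI)+r_k\rho_k(\vec v^+-\vec v_k)\times\vec B-\frac{r_k\rho_k}{n_ee}\big((\nabla\times\vec B)\times\vec B-\nabla p_e\big)=0,$$ $$\partial_tE_k+\nabla\cdot\big(\vec v_k(\mathcal E_k+p_k)+c_h\psi\vec B\big)+r_k\rho_k\vec v_k\cdot\big((\vec v^+-\vec v_k)\times\vec B\big)-\frac{r_k\rho_k\vec v_k}{n_ee}\cdot\big((\nabla\times\vec B)\times\vec B-\nabla p_e\big)-\vec B\cdot\big(\nabla\times(\vec v^+\times\vec B)\big)+\psi\,\vec v^+\cdot\nabla\psi=0,$$ $$\partial_t\vec B+\nabla(c_h\psi)-\nabla\times(\vec v^+\times\vec B)=0,\qquad \partial_t\psi+\nabla\cdot(c_h\vec B)+\vec v^+\cdot\nabla\psi=0.$$ Let $S=\sum_{k}\frac{-\rho_ks_k}{\gamma_k-1}$ with $$s_k=\ln\Big((\gamma_k-1)\Big(E_k-\frac1{2\rho_k}\|\rho_k\vec v_k\|^2-\frac12\|\vec B\|^2-\frac12\psi^2\Big)\Big)-\gamma_k\ln\rho_k .$$ Then: (i) the entropy variables $\mathbf w=\partial S/\partial\mathbf u$ have the components $\frac{\gamma_k-s_k}{\gamma_k-1}-\beta_k\|\vec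 v_k\|^2$, $2\beta_k\vec v_k$, $-2\beta_k$ (with respect to $\rho_k$, $\rho_k\vec v_k$, $E_k$, for $k=1,\dots,N_i$), $2\beta_+\vec B$ (with respect to $\vec B$) and $2\beta_+\psi$ (with respect to $\psi$), and the map $\mathbf u\mapsto\mathbf w$ is a bijection from the set of admissible states onto its image; (ii) every smooth solution with values in the set of admissible states satisfies $$\frac{\partial S}{\partial t}+\nabla\cdot\vec f^S=0,\qquad\vec f^S=\sum_{k=1}^{N_i}\vec v_k\Big(\frac{-\rho_ks_k}{\gamma_k-1}\Big).$$
   Context: There are $N_i\ge1$ ion species with constants $\gamma_k>1$ (heat capacity ratios) and $r_k$ (charge-to-mass ratios). For species $k$: density $\rho_k$, velocity $\vec v_k\in\mathbb R^3$, pressure $p_k$, hydrodynamic energy $\mathcal E_k=\tfrac12\rho_k\|\vec v_k\|^2+\frac{p_k}{\gamma_k-1}$; $\vec B$ is the magnetic field, $\psi$ is a scalar field (the generalized Lagrange multiplier, GLM, for divergence cleaning), and $E_k=\mathcal E_k+\frac12\|\vec B\|^2+\frac12\psi^2$. The state vector $\mathbf u\in\mathbb R^{5N_i+4}$ consists of all $\rho_k,\rho_k\vec v_k,E_k$ together with $\vec B,\psi$. A state is admissible if $\rho_k>0$ and $p_k>0$ for all $k$. The constant $c_h$ is the divergence cleaning speed (constant in space). $n_ee=\sum_kr_k\rho_k$ (assumed nonzero), $\vec v^+=\frac1{n_ee}\sum_kr_k\rho_k\vec v_k$, and $p_e$ is a given smooth scalar field (electron pressure). $\beta_k=\frac{\rho_k}{2p_k}$,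 $\beta_+=\sum_k\beta_k$. No assumption is made on $\nabla\cdot\vec B$. *)

(* Defs.v *)
From HB Require Import structures.
From mathcomp Require Import all_boot all_order all_algebra.
From mathcomp Require Import all_classical all_reals all_analysis.

Set Implicit Arguments.
Unset Strict Implicit.
Unset Printing Implicit Defensive.

Import Order.TTheory GRing.Theory Num.Theory.
Import numFieldNormedType.Exports.

Local Open Scope classical_set_scope.
Local Open Scope ring_scope.

Section VectorCalculus.
Variable R : realType.

Definition dot (a b : 'rV[R]_3) : R := \sum_(i < 3) a 0 i * b 0 i.

(* The norm `|a| of the library on row vectors is the sup norm, so the squared
   Euclidean norm is written separately. *)
Definition normsq (a : 'rV[R]_3) : R := dot a a.

(* Indices live in the ring 'I_3, i.e. they are taken modulo 3. *)
Definition cross (a b : 'rV[R]_3) : 'rV[R]_3 :=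
  \row_(i < 3) (a 0 (i + 1) * b 0 (i + 2) - a 0 (i + 2) * b 0 (i + 1)).

Section Derivatives.
Variable V : normedModType R.

Definition dt (f : R * 'rV[R]_3 -> V) (z : R * 'rV[R]_3) : V :=
  'D_(1, 0) f z.

Definition dx (i : 'I_3) (f : R * 'rV[R]_3 -> V) (z : R * 'rV[R]_3) : V :=
  'D_(0, delta_mx 0 i) f z.

Definition C1_on (D : set (R * 'rV[R]_3)) (f : R * 'rV[R]_3 -> V) : Prop :=
  forall z, D z ->
    differentiable f z /\ forall h, {for z, continuous ('D_h f)}.

End Derivatives.

Definition grad (f : R * 'rV[R]_3 -> R) (z : R * 'rV[R]_3) : 'rV[R]_3 :=
  \row_(i < 3) dx i f z.

Definition dvg (F : R * 'rV[R]_3 -> 'rV[R]_3) (z : R * 'rV[R]_3) : R :=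
  \sum_(i < 3) dx i (fun y => F y 0 i) z.

Definition dvg_mx (T : R * 'rV[R]_3 -> 'M[R]_3) (z : R * 'rV[R]_3) :
    'rV[R]_3 :=
  \row_(i < 3) \sum_(j < 3) dx j (fun y => T y i j) z.

Definition curl (F : R * 'rV[R]_3 -> 'rV[R]_3) (z : R * 'rV[R]_3) :
    'rV[R]_3 :=
  \row_(i < 3) (dx (i + 1) (fun y => F y 0 (i + 2)) z -
                dx (i + 2) (fun y => F y 0 (i + 1)) z).

End VectorCalculus.

(* State vectors of R^(5N+4): N species blocks (rho_k, rho_k v_k, E_k) of size
   1 + 3 + 1, followed by (B, psi) of size 3 + 1. *)
Notation state R N := 'rV[R]_(N * (1 + 3 + 1) + (3 + 1)).

Section State.
Variables (R : realType) (N : nat).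
Implicit Types (u : state R N) (k : 'I_N).

Definition species u k : 'rV[R]_(1 + 3 + 1) := row k (vec_mx (lsubmx u)).

Definition rho u k : R := lsubmx (lsubmx (species u k)) 0 0.
Definition mom u k : 'rV[R]_3 := rsubmx (lsubmx (species u k)).
Definition energy u k : R := rsubmx (species u k) 0 0.
Definition mag u : 'rV[R]_3 := lsubmx (rsubmx u).
Definition psi u : R := rsubmx (rsubmx u) 0 0.

Definition vel u k : 'rV[R]_3 := (rho u k)^-1 *: mom u k.

Section Thermodynamics.
Variable gamma : 'I_N -> R.

(* Solves E_k = rho_k |v_k|^2 / 2 + p_k / (gamma_k - 1) + |B|^2 / 2 + psi^2 / 2
   for p_k. *)
Definition pressure u k : R :=
  (gamma k - 1) * (energy u k - (2 * rho u k)^-1 * normsq (mom u k)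
                   - 2^-1 * normsq (mag u) - 2^-1 * psi u ^+ 2).

Definition hydro_energy u k : R :=
  2^-1 * rho u k * normsq (vel u k) + pressure u k / (gamma k - 1).

Definition admissible : set (state R N) :=
  [set u | forall k, 0 < rho u k /\ 0 < pressure u k].

Definition beta u k : R := rho u k / (2 * pressure u k).
Definition beta_plus u : R := \sum_k beta u k.

Definition spec_entropy u k : R := ln (pressure u k) - gamma k * ln (rho u k).

Definition entropy u : R :=
  \sum_k (- rho u k * spec_entropy u k) / (gamma k - 1).

Definition entropy_vars u : state R N :=
  \row_j 'D_(delta_mx 0 j) entropy u.

Definition entropy_flux u : 'rV[R]_3 :=
  \sum_k ((- rho u k * spec_entropy u k) / (gamma k - 1)) *: vel u k.

End Thermodynamics.

Section System.
Variables (gamma r : 'I_N -> R).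

(* The product n_e e. *)
Definition nee u : R := \sum_k r k * rho u k.

Definition vplus u : 'rV[R]_3 :=
  (nee u)^-1 *: \sum_k (r k * rho u k) *: vel u k.

(* The cleaning speed is constant in space but may depend on time. *)
Variables (ch : R -> R) (pe : R * 'rV[R]_3 -> R).
Variable U : R * 'rV[R]_3 -> state R N.
Implicit Type z : R * 'rV[R]_3.

Definition slip_force z k : 'rV[R]_3 :=
  (r k * rho (U z) k) *: cross (vplus (U z) - vel (U z) k) (mag (U z)).

Definition current_force z k : 'rV[R]_3 :=
  (r k * rho (U z) k / nee (U z)) *:
    (cross (curl (mag \o U) z) (mag (U z)) - grad pe z).

Definition curl_vplus_mag z : 'rV[R]_3 :=
  curl (fun y => cross (vplus (U y)) (mag (U y))) z.

Definition mass_eq z k : Prop :=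
  dt (fun y => rho (U y) k) z + dvg (fun y => mom (U y) k) z = 0.

Definition momentum_eq z k : Prop :=
  dt (fun y => mom (U y) k) z
  + dvg_mx (fun y => rho (U y) k *: ((vel (U y) k)^T *m vel (U y) k)
                     + (pressure gamma (U y) k)%:M) z
  + slip_force z k - current_force z k = 0.

Definition energy_eq z k : Prop :=
  dt (fun y => energy (U y) k) z
  + dvg (fun y => (hydro_energy gamma (U y) k + pressure gamma (U y) k)
                    *: vel (U y) k
                  + (ch y.1 * psi (U y)) *: mag (U y)) z
  + dot (vel (U z) k) (slip_force z k)
  - dot (vel (U z) k) (current_force z k)
  - dot (mag (U z)) (curl_vplus_mag z)
  + psi (U z) * dot (vplus (U z)) (grad (psi \o U) z) = 0.

Definition induction_eq z : Prop :=
  dt (mag \o U) z + grad (fun y => ch y.1 * psi (U y)) z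
  - curl_vplus_mag z = 0.

Definition cleaning_eq z : Prop :=
  dt (psi \o U) z + dvg (fun y => ch y.1 *: mag (U y)) z
  + dot (vplus (U z)) (grad (psi \o U) z) = 0.

Definition multi_ion_glm_mhd (D : set (R * 'rV[R]_3)) : Prop :=
  forall z, D z ->
    [/\ forall k, mass_eq z k, forall k, momentum_eq z k,
        forall k, energy_eq z k, induction_eq z & cleaning_eq z].

End System.
End State.

(* Main.v *)
Require Import Defs.
From HB Require Import structures.
From mathcomp Require Import all_boot all_order all_algebra.
From mathcomp Require Import all_classical all_reals all_analysis.
From mathcomp Require Import ring.

Set Implicit Arguments.
Unset Strict Implicit.
Unset Printing Implicit Defensive.

Import Order.TTheory GRing.Theory Num.Theory.
Import numFieldNormedType.Exports.

Local Open Scope classical_set_scope.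
Local Open Scope ring_scope.

(** The conservation law is a pointwise identity between directional
    derivatives.  Write S_k = - rho_k s_k / (gamma_k - 1).  Along any direction,
      d S_k = (gamma_k - s_k) / (gamma_k - 1) d rho_k
              - 2 beta_k / (gamma_k - 1) d p_k
    (is_derive_species_entropy), where, p_k being explicit in the state,
      d p_k / (gamma_k - 1) = d E_k - v_k . d(rho_k v_k) + |v_k|^2 / 2 d rho_k
                              - B . d B - psi d psi
    (is_derive_pressure).  Both formulas hold for every differentiable map into
    state space.  Applied to the identity of state space they give the entropy
    variables; applied to a solution they give the entropy balance.

    For the entropy variables, evaluate dS on the unit vectors of state space.
    The resulting formulas can be solved for the state: the energy components
    give the beta_k, then the momentum components give the v_k, the density
    components give the s_k, and s_k and beta_k determine rho_k because
    s_k = (1 - gamma_k) ln rho_k - ln (2 beta_k) with gamma_k <> 1; finally B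
    and psi are recovered on dividing by 2 beta_+ > 0, which uses that there is at
    least one species.

    For the balance, insert the five equations into d_t p_k.  The Lorentz and
    pressure forces cancel between the energy equation and v_k . (momentum
    equation); the term B . curl (v^+ x B) cancels against the induction
    equation, the term psi v^+ . grad psi against the cleaning equation, and
    c_h div (psi B) against c_h B . grad psi + c_h psi div B, with no condition
    on div B.  What remains is the internal energy equation of a single gas,
      d_t p_k + v_k . grad p_k + gamma_k p_k div v_k = 0
    (pressure_balance).  With the continuity equation it makes
    d_t S_k + div (S_k v_k) vanish for each species separately
    (species_entropy_balance); the sum over k is the theorem. *)

(** * Directional derivatives *)

Section DirectionalCalculus.
Variables (R : realType) (V : normedModType R).
Implicit Types (f g : V -> R) (z h : V).

Lemma is_derive_fun_add f g z h df dg :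
  is_derive z h f df -> is_derive z h g dg ->
  is_derive z h (fun y => f y + g y) (df + dg).
Proof. exact: is_deriveD. Qed.

Lemma is_derive_fun_sub f g z h df dg :
  is_derive z h f df -> is_derive z h g dg ->
  is_derive z h (fun y => f y - g y) (df - dg).
Proof. exact: is_deriveB. Qed.

Lemma is_derive_fun_mul f g z h df dg :
  is_derive z h f df -> is_derive z h g dg ->
  is_derive z h (fun y => f y * g y) (df * g z + f z * dg).
Proof.
move=> hf hg; apply: (is_derive_eq (is_deriveM hf hg)).
by rewrite addrC /GRing.scale /= [g z * _]mulrC.
Qed.

Lemma is_derive_fun_scale a f z h df :
  is_derive z h f df -> is_derive z h (fun y => a * f y) (a * df).
Proof. exact: is_deriveZ. Qed.

Lemma is_derive_fun_sum n (f : 'I_n -> V -> R) z h (df : 'I_n -> R) :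
  (forall i, is_derive z h (f i) (df i)) ->
  is_derive z h (fun y => \sum_i f i y) (\sum_i df i).
Proof.
move=> hf; have := is_derive_sum hf; congr (is_derive _ _ _ _).
by apply/funext => y; rewrite fct_sumE.
Qed.

Lemma is_derive_fun_inv f z h df :
  f z != 0 -> is_derive z h f df ->
  is_derive z h (fun y => (f y)^-1) (- (f z)^-2 * df).
Proof.
move=> fz0 [hf <-]; split; [exact: derivableV | exact: deriveV].
Qed.

(** The chain rule is needed for a function that has merely a derivative in the
    direction h, so it is read off on the line through z in that direction. *)
Lemma is_derive_ln f z h df :
  0 < f z -> is_derive z h f df ->
  is_derive z h (fun y => ln (f y)) (df / f z).
Proof.
move=> fz0 hf.
pose line (u : V -> R) (t : R) := u (t *: h + z).
have line0 (u : V -> R) : line u 0 = u z by rewrite /line scale0r add0r.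
have deriveline (u : V -> R) : 'D_h u z = 'D_1 (line u) 0.
  rewrite /derive; set q1 := fun t => _; set q2 := fun t => _.
  suff -> : q1 = q2 by []; apply/funext => t; rewrite /q1 /q2 /=.
  by rewrite addr0 [_ *: 1]mulr1 /line scale0r add0r.
have hline : is_derive (0 : R) (1 : R) (line f) df.
  split; first by case: hf => hf _; exact: (proj1 (derivable1P _ _ _) hf).
  by rewrite -deriveline; case: hf.
have hln : is_derive (line f 0) (1 : R) (@ln R) (line f 0)^-1.
  by apply: is_derive1_ln; rewrite line0.
have [hd hv] := is_derive1_comp hln hline.
rewrite line0 in hv; split; first exact: (proj2 (derivable1P _ _ _) hd).
by rewrite deriveline mulrC -hv.
Qed.

Lemma is_derive_coord m n (M : V -> 'M[R]_(m, n)) z h dM i j :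
  is_derive z h M dM -> is_derive z h (fun y => M y i j) (dM i j).
Proof.
move=> [hM <-]; split; first by have /derivable_mxP := hM.
by rewrite derive_mx// mxE.
Qed.

(** The cleaning speed is an arbitrary function of time, so only its derivatives
    in the spatial directions exist in general: along these it is constant. *)
Lemma is_derive_frozen f z h :
  (forall t : R, f (t *: h + z) = f z) -> is_derive z h f 0.
Proof.
move=> fE; suff hc : (fun t => t^-1 *: ((f \o shift z) (t *: h) - f z))
    @ 0^' --> (0 : R).
  by split; [apply/cvg_ex; exists 0 | exact/cvg_lim].
rewrite (_ : (fun t => _) = cst 0); first exact: cvg_cst.
by apply/funext => t /=; rewrite fE subrr scaler0.
Qed.

End DirectionalCalculus.

(** * The components of a state as coordinates *)

Section Coordinates.
Variables (R : realType) (N : nat).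
Implicit Types (u : state R N) (k : 'I_N) (i : 'I_3).

Definition species_index k (a : 'I_(1 + 3 + 1)) :
    'I_(N * (1 + 3 + 1) + (3 + 1)) :=
  lshift (3 + 1) (mxvec_index k a).
Definition rho_index k := species_index k (lshift 1 (lshift 3 ord0)).
Definition mom_index k i := species_index k (lshift 1 (rshift 1 i)).
Definition energy_index k := species_index k (rshift (1 + 3) ord0).
Definition mag_index i : 'I_(N * (1 + 3 + 1) + (3 + 1)) :=
  rshift _ (lshift 1 i).
Definition psi_index : 'I_(N * (1 + 3 + 1) + (3 + 1)) :=
  rshift _ (rshift 3 ord0).

Lemma rhoE u k : rho u k = u 0 (rho_index k).
Proof. by rewrite /rho /species !mxE. Qed.
Lemma momE u k i : mom u k 0 i = u 0 (mom_index k i).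
Proof. by rewrite /mom /species !mxE. Qed.
Lemma energyE u k : energy u k = u 0 (energy_index k).
Proof. by rewrite /energy /species !mxE. Qed.
Lemma magE u i : mag u 0 i = u 0 (mag_index i).
Proof. by rewrite /mag !mxE. Qed.
Lemma psiE u : psi u = u 0 psi_index.
Proof. by rewrite /psi !mxE. Qed.

Lemma species_index_eq k a l b :
  (species_index k a == species_index l b) = (k == l) && (a == b).
Proof.
rewrite /species_index eq_lshift; apply/eqP/andP => [|[/eqP-> /eqP->]//].
by move=> /cast_ord_inj/enum_rank_inj[-> ->].
Qed.

Lemma state_ext u u' :
  (forall k, rho u k = rho u' k) -> (forall k, mom u k = mom u' k) ->
  (forall k, energy u k = energy u' k) -> mag u = mag u' -> psi u = psi u' ->
  u = u'.
Proof.
move=> hrho hmom hE hB hpsi.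
suff hblk : lsubmx u = lsubmx u'.
  suff hfld : rsubmx u = rsubmx u'.
    by rewrite -[u]hsubmxK -[u']hsubmxK hblk hfld.
  rewrite -[rsubmx u]hsubmxK -[rsubmx u']hsubmxK; congr row_mx => //.
  by apply/rowP => j; rewrite ord1; exact: hpsi.
rewrite -[lsubmx u]vec_mxK -[lsubmx u']vec_mxK; congr mxvec.
apply/row_matrixP => k; rewrite -/(species u k) -/(species u' k).
rewrite -[species u k]hsubmxK -[species u' k]hsubmxK; congr row_mx; last first.
  by apply/rowP => j; rewrite ord1; exact: hE.
rewrite -[lsubmx _]hsubmxK -[lsubmx (species u' k)]hsubmxK; congr row_mx.
  by apply/rowP => j; rewrite ord1; exact: hrho.
exact: hmom.
Qed.

End Coordinates.

Section VectorDerivatives.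
Variables (R : realType) (V : normedModType R).
Implicit Types (F G : V -> 'rV[R]_3) (z h : V).

Lemma is_derive_mx m n (M : V -> 'M[R]_(m, n)) z h (dM : 'M[R]_(m, n)) :
  (forall i j, is_derive z h (fun y => M y i j) (dM i j)) ->
  is_derive z h M dM.
Proof.
move=> hM; have hd : derivable M z h.
  by apply/derivable_mxP => i j; case: (hM i j).
split=> //; rewrite derive_mx//; apply/matrixP => i j; rewrite mxE.
by case: (hM i j).
Qed.

Lemma dotC (a b : 'rV[R]_3) : dot a b = dot b a.
Proof. by apply: eq_bigr => i _; rewrite mulrC. Qed.

Lemma dotZl c (a b : 'rV[R]_3) : dot (c *: a) b = c * dot a b.
Proof. by rewrite /dot mulr_sumr; apply: eq_bigr => i _; rewrite mxE mulrA. Qed.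

Lemma is_derive_dot F G z h dF dG :
  is_derive z h F dF -> is_derive z h G dG ->
  is_derive z h (fun y => dot (F y) (G y)) (dot dF (G z) + dot (F z) dG).
Proof.
move=> hF hG; rewrite /dot -big_split /=.
apply: is_derive_fun_sum => i.
by apply: is_derive_fun_mul; apply: is_derive_coord.
Qed.

Lemma is_derive_normsq F z h dF :
  is_derive z h F dF ->
  is_derive z h (fun y => normsq (F y)) (2 * dot (F z) dF).
Proof.
move=> hF; apply: (is_derive_eq (is_derive_dot hF hF)).
by rewrite dotC; ring.
Qed.

End VectorDerivatives.

(** * Derivatives of pressure and entropy along a map into state space *)

Section StateDerivatives.
Variables (R : realType) (N : nat) (gamma : 'I_N -> R).
Variables (V : normedModType R) (U : V -> state R N) (z h : V).
Variable dU : state R N.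
Hypothesis hU : is_derive z h U dU.
Implicit Types (u du : state R N) (k : 'I_N).

Lemma is_derive_rho k : is_derive z h (fun y => rho (U y) k) (rho dU k).
Proof.
rewrite rhoE; have := is_derive_coord 0 (rho_index k) hU.
by congr is_derive; apply/funext => y; rewrite rhoE.
Qed.

Lemma is_derive_mom k : is_derive z h (fun y => mom (U y) k) (mom dU k).
Proof.
apply: is_derive_mx => o i; rewrite (ord1 o) momE.
have := is_derive_coord 0 (mom_index k i) hU.
by congr is_derive; apply/funext => y; rewrite momE.
Qed.

Lemma is_derive_energy k :
  is_derive z h (fun y => energy (U y) k) (energy dU k).
Proof.
rewrite energyE; have := is_derive_coord 0 (energy_index k) hU.
by congr is_derive; apply/funext => y; rewrite energyE.
Qed.

Lemma is_derive_mag : is_derive z h (fun y => mag (U y)) (mag dU).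
Proof.
apply: is_derive_mx => o i; rewrite (ord1 o) magE.
have := is_derive_coord 0 (mag_index N i) hU.
by congr is_derive; apply/funext => y; rewrite magE.
Qed.

Lemma is_derive_psi : is_derive z h (fun y => psi (U y)) (psi dU).
Proof.
rewrite psiE; have := is_derive_coord 0 (psi_index N) hU.
by congr is_derive; apply/funext => y; rewrite psiE.
Qed.

Lemma is_derive_vel k : rho (U z) k != 0 ->
  is_derive z h (fun y => vel (U y) k)
    ((rho (U z) k)^-1 *: (mom dU k - rho dU k *: vel (U z) k)).
Proof.
move=> rho0; apply: is_derive_mx => o i.
rewrite (_ : (fun y => _) = fun y => (rho (U y) k)^-1 * mom (U y) k o i);
  last by apply/funext => y; rewrite mxE.
apply: is_derive_eq.
  apply: is_derive_fun_mul; first exact: is_derive_fun_inv (is_derive_rho k).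
  exact: is_derive_coord (is_derive_mom k).
by rewrite !mxE; field.
Qed.

(** The differential of the pressure of species k at u, in the direction du. *)
Definition pressure_diff u du k : R :=
  (gamma k - 1) * (energy du k - dot (vel u k) (mom du k)
                   + 2^-1 * rho du k * normsq (vel u k)
                   - dot (mag u) (mag du) - psi u * psi du).

Lemma is_derive_pressure k : rho (U z) k != 0 ->
  is_derive z h (fun y => pressure gamma (U y) k) (pressure_diff (U z) dU k).
Proof.
move=> rho0; apply: is_derive_eq.
  apply: is_derive_fun_scale; apply: is_derive_fun_sub; last first.
    apply: is_derive_fun_scale.
    exact: is_derive_fun_mul is_derive_psi is_derive_psi.
  apply: is_derive_fun_sub; last first.
    exact: is_derive_fun_scale (is_derive_normsq is_derive_mag).
  apply: is_derive_fun_sub; first exact: is_derive_energy.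
  apply: is_derive_fun_mul; last exact: is_derive_normsq (is_derive_mom k).
  apply: is_derive_fun_inv; first by rewrite mulf_neq0 ?pnatr_eq0.
  exact: is_derive_fun_scale (is_derive_rho k).
rewrite /pressure_diff /vel /normsq !dotZl (dotC _ (_ *: _)) dotZl.
by field.
Qed.

Definition species_entropy u k : R :=
  (- rho u k * spec_entropy gamma u k) / (gamma k - 1).

(** Since beta = rho / (2 p), the coefficient of dp is - rho / p up to the
    factor 1 / (gamma - 1). *)
Lemma is_derive_species_entropy k :
  0 < rho (U z) k -> 0 < pressure gamma (U z) k -> 1 < gamma k ->
  is_derive z h (fun y => species_entropy (U y) k)
    ((gamma k - spec_entropy gamma (U z) k) / (gamma k - 1) * rho dU k
     - 2 * beta gamma (U z) k / (gamma k - 1) * pressure_diff (U z) dU k).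
Proof.
move=> rho_gt0 p_gt0 gamma_gt1; have rho0 := lt0r_neq0 rho_gt0.
have p0 := lt0r_neq0 p_gt0.
rewrite (_ : (fun y => _) = fun y => - (gamma k - 1)^-1 *
    (rho (U y) k * spec_entropy gamma (U y) k)); last first.
  by apply/funext => y; rewrite /species_entropy; ring.
apply: is_derive_eq.
  apply: is_derive_fun_scale; apply: is_derive_fun_mul (is_derive_rho k) _.
  apply: is_derive_fun_sub; first exact: is_derive_ln (is_derive_pressure _).
  apply: is_derive_fun_scale; exact: is_derive_ln (is_derive_rho k).
rewrite /beta; set s := spec_entropy _ _ _.
have g0 : gamma k - 1 != 0 by rewrite subr_eq0 gt_eqF.
by field; rewrite g0 p0 rho0.
Qed.

Lemma is_derive_entropy : admissible gamma (U z) -> (forall k, 1 < gamma k) ->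
  is_derive z h (fun y => entropy gamma (U y))
    (\sum_k ((gamma k - spec_entropy gamma (U z) k) / (gamma k - 1) * rho dU k
     - 2 * beta gamma (U z) k / (gamma k - 1) * pressure_diff (U z) dU k)).
Proof.
move=> hadm hgamma; apply: is_derive_fun_sum => k.
by apply: is_derive_species_entropy; rewrite ?hgamma//; case: (hadm k).
Qed.

End StateDerivatives.

(** * The entropy variables and their inversion *)

Section EntropyVariables.
Variables (R : realType) (N : nat) (gamma : 'I_N -> R).
Hypothesis hgamma : forall k, 1 < gamma k.
Implicit Types (u : state R N) (k l : 'I_N).

Local Notation unit_state j := (delta_mx 0 j : state R N).

Lemma rho_unit k j : rho (unit_state j) k = (rho_index k == j)%:R.
Proof. by rewrite rhoE mxE eqxx. Qed.
Lemma mom_unit k i j : mom (unit_state j) k 0 i = (mom_index k i == j)%:R.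
Proof. by rewrite momE mxE eqxx. Qed.
Lemma energy_unit k j : energy (unit_state j) k = (energy_index k == j)%:R.
Proof. by rewrite energyE mxE eqxx. Qed.
Lemma mag_unit i j : mag (unit_state j) 0 i = (mag_index N i == j)%:R.
Proof. by rewrite magE mxE eqxx. Qed.
Lemma psi_unit j : psi (unit_state j) = (psi_index N == j)%:R.
Proof. by rewrite psiE mxE eqxx. Qed.

(** Decides equality of any two coordinate positions of a state. *)
Definition index_eqE :=
  (species_index_eq, eq_lrshift, eq_rlshift, eq_lshift, eq_rshift, eqxx,
   andbF, andbT).

Lemma entropy_diff u : admissible gamma u -> differentiable (entropy gamma) u.
Proof.
move=> hadm.
have dcoord j : differentiable (fun v : state R N => v 0 j) u.
  exact: differentiable_coord.
have drho k : differentiable (fun v : state R N => rho v k) u.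
  by under eq_fun do rewrite rhoE; exact: dcoord.
have dmom k i : differentiable (fun v : state R N => mom v k 0 i) u.
  by under eq_fun do rewrite momE; exact: dcoord.
have denergy k : differentiable (fun v : state R N => energy v k) u.
  by under eq_fun do rewrite energyE; exact: dcoord.
have dmag i : differentiable (fun v : state R N => mag v 0 i) u.
  by under eq_fun do rewrite magE; exact: dcoord.
have dpsi : differentiable (fun v : state R N => psi v) u.
  by under eq_fun do rewrite psiE; exact: dcoord.
have dsum n (f : 'I_n -> state R N -> R) :
    (forall i, differentiable (f i) u) ->
    differentiable (fun v => \sum_i f i v) u.
  move=> /differentiable_sum df; rewrite (_ : (fun v => _) = \sum_i f i)//.
  by apply/funext => v; rewrite fct_sumE.
have dnormsq (F : state R N -> 'rV[R]_3) :
    (forall i, differentiable (fun v => F v 0 i) u) ->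
    differentiable (fun v => normsq (F v)) u.
  by move=> dF; apply: dsum => i; apply: differentiableM.
have dln (f : state R N -> R) : 0 < f u -> differentiable f u ->
    differentiable (fun v => ln (f v)) u.
  move=> f0 df; apply: (@differentiable_comp _ _ _ _ f (@ln R)) => //.
  by apply/derivable1_diffP; case: (is_derive1_ln f0).
apply: dsum => k; have [rho_gt0 p_gt0] := hadm k.
have dp : differentiable (fun v : state R N => pressure gamma v k) u.
  apply: (@differentiableZ _ _ _ (fun v => energy v k - _ - _ - _)).
  apply: differentiableB; last first.
    apply: (@differentiableZ _ _ _ (fun v => psi v ^+ 2)).
    exact: (differentiableM dpsi dpsi).
  apply: differentiableB; last first.
    apply: (@differentiableZ _ _ _ (fun v => normsq (mag v))).
    exact: dnormsq.
  apply: differentiableB => //; apply: differentiableM; last exact: dnormsq.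
  apply: differentiableV; first exact: differentiableZ.
  by rewrite mulf_neq0 ?pnatr_eq0// lt0r_neq0.
apply: differentiableM; last exact: differentiable_cst.
apply: differentiableM; first exact: differentiableN.
apply: differentiableB; first exact: dln.
apply: (@differentiableZ _ _ _ (fun v => ln (rho v k))); exact: dln.
Qed.

(** The differential of the entropy on the j-th unit vector, whose components
    are all 0 except for one equal to 1; the factors gamma_k - 1 coming from the
    pressure have cancelled. *)
Lemma entropy_varsE u j : admissible gamma u ->
  entropy_vars gamma u 0 j =
  \sum_k (((gamma k - spec_entropy gamma u k) / (gamma k - 1)
           - beta gamma u k * normsq (vel u k)) * (rho_index k == j)%:R
     + 2 * beta gamma u k *
       (\sum_i vel u k 0 i * (mom_index k i == j)%:R
        - (energy_index k == j)%:R
        + \sum_i mag u 0 i * (mag_index N i == j)%:R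
        + psi u * (psi_index N == j)%:R)).
Proof.
move=> hadm; rewrite mxE.
have [_ ->] := is_derive_entropy (is_derive_id u (unit_state j)) hadm hgamma.
apply: eq_bigr => k _.
rewrite /pressure_diff rho_unit energy_unit psi_unit /dot.
under eq_bigr do rewrite mom_unit.
under [X in _ - X - psi u * _]eq_bigr do rewrite mag_unit.
have g0 : gamma k - 1 != 0 by rewrite subr_eq0 gt_eqF.
by field.
Qed.

Lemma sum_pick (I : finType) (a : I -> R) (b : pred I) (x0 : I) :
  (forall x, b x = (x == x0)) -> \sum_x a x * (b x)%:R = a x0.
Proof.
move=> bE; rewrite (bigD1 x0)//= bE eqxx mulr1 big1 ?addr0// => x /negPf xx0.
by rewrite bE xx0 mulr0.
Qed.

Lemma sum_none (I : finType) (a : I -> R) (b : pred I) :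
  (forall x, b x = false) -> \sum_x a x * (b x)%:R = 0.
Proof. by move=> bE; rewrite big1// => x _; rewrite bE mulr0. Qed.

Lemma entropy_vars_rho u k : admissible gamma u ->
  rho (entropy_vars gamma u) k =
  (gamma k - spec_entropy gamma u k) / (gamma k - 1)
  - beta gamma u k * normsq (vel u k).
Proof.
move=> hadm; rewrite rhoE entropy_varsE//.
pose c l := (gamma l - spec_entropy gamma u l) / (gamma l - 1)
  - beta gamma u l * normsq (vel u l).
rewrite -/(c k) -[RHS](@sum_pick _ c (fun l => l == k))//.
apply: eq_bigr => l _; rewrite !sum_none => [|i|i]; rewrite !index_eqE//.
by rewrite !(mulr0, addr0, subr0).
Qed.

Lemma entropy_vars_mom u k : admissible gamma u ->
  mom (entropy_vars gamma u) k = (2 * beta gamma u k) *: vel u k.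
Proof.
move=> hadm; apply/rowP => i; rewrite momE entropy_varsE// mxE.
pose c l := 2 * beta gamma u l * vel u l 0 i.
rewrite -/(c k) -[RHS](@sum_pick _ c (fun l => l == k))//.
apply: eq_bigr => l _; rewrite [X in _ + X + _]sum_none => [|i']; last first.
  by rewrite !index_eqE.
have [->|lk] := eqVneq l k.
  rewrite (sum_pick _ (x0 := i)) => [|i']; last by rewrite !index_eqE.
  by rewrite !index_eqE /c /=; ring.
rewrite sum_none => [|i']; last by rewrite !index_eqE (negPf lk).
by rewrite !index_eqE /=; ring.
Qed.

Lemma entropy_vars_energy u k : admissible gamma u ->
  energy (entropy_vars gamma u) k = - 2 * beta gamma u k.
Proof.
move=> hadm; rewrite energyE entropy_varsE//.
pose c l := - 2 * beta gamma u l.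
rewrite -/(c k) -[RHS](@sum_pick _ c (fun l => l == k))//.
apply: eq_bigr => l _; rewrite !sum_none => [|i|i]; rewrite !index_eqE//.
by rewrite /c /=; ring.
Qed.

Lemma entropy_vars_mag u : admissible gamma u ->
  mag (entropy_vars gamma u) = (2 * beta_plus gamma u) *: mag u.
Proof.
move=> hadm; apply/rowP => i; rewrite magE entropy_varsE// mxE.
rewrite /beta_plus mulr_sumr mulr_suml; apply: eq_bigr => l _.
rewrite sum_none => [|i']; last by rewrite !index_eqE.
rewrite (sum_pick _ (x0 := i)) => [|i']; last by rewrite !index_eqE.
by rewrite !index_eqE /=; ring.
Qed.

Lemma entropy_vars_psi u : admissible gamma u ->
  psi (entropy_vars gamma u) = 2 * beta_plus gamma u * psi u.
Proof.
move=> hadm; rewrite psiE entropy_varsE//.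
rewrite /beta_plus mulr_sumr mulr_suml; apply: eq_bigr => l _.
rewrite !sum_none => [|i|i]; rewrite !index_eqE//.
by rewrite /=; ring.
Qed.

Lemma pressure_beta u k : admissible gamma u ->
  pressure gamma u k = rho u k / (2 * beta gamma u k).
Proof.
move=> /(_ k)[/lt0r_neq0 r0 /lt0r_neq0 p0]; rewrite /beta.
by field; rewrite p0 r0.
Qed.

Lemma beta_gt0 u k : admissible gamma u -> 0 < beta gamma u k.
Proof. by move=> /(_ k)[r0 p0]; rewrite divr_gt0// mulr_gt0. Qed.

(** Eliminating the pressure through beta leaves an entropy that is strictly
    monotone in the density when gamma <> 1, which makes rho recoverable. *)
Lemma spec_entropy_beta u k : admissible gamma u ->
  spec_entropy gamma u k =
  (1 - gamma k) * ln (rho u k) - ln (2 * beta gamma u k).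
Proof.
move=> hadm; have [r0 _] := hadm k; have b0 := beta_gt0 k hadm.
have tb0 : 0 < 2 * beta gamma u k by rewrite mulr_gt0.
rewrite /spec_entropy pressure_beta// ln_div ?posrE//; ring.
Qed.

Lemma energy_pressure u k : energy u k =
  pressure gamma u k / (gamma k - 1) + (2 * rho u k)^-1 * normsq (mom u k)
  + 2^-1 * normsq (mag u) + 2^-1 * psi u ^+ 2.
Proof.
have g0 : gamma k - 1 != 0 by rewrite subr_eq0 gt_eqF.
by rewrite /pressure mulrAC mulfV// mul1r; ring.
Qed.

Lemma mom_vel u k : admissible gamma u -> mom u k = rho u k *: vel u k.
Proof.
by move=> /(_ k)[/lt0r_neq0 r0 _]; rewrite /vel scalerA mulfV// scale1r.
Qed.

(** The components of the admissible state with entropy variables w, if there is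
    one, obtained by solving the formulas for w in the order beta, v, s, rho, B,
    psi, E. *)
Section Inversion.
Variable w : state R N.

Definition inv_beta k : R := - energy w k / 2.
Definition inv_vel k : 'rV[R]_3 := (2 * inv_beta k)^-1 *: mom w k.
Definition inv_spec_entropy k : R :=
  gamma k - (gamma k - 1) * (rho w k + inv_beta k * normsq (inv_vel k)).
Definition inv_rho k : R :=
  expR ((1 - gamma k)^-1 * (inv_spec_entropy k + ln (2 * inv_beta k))).
Definition inv_mag : 'rV[R]_3 := (2 * \sum_k inv_beta k)^-1 *: mag w.
Definition inv_psi : R := (2 * \sum_k inv_beta k)^-1 * psi w.
Definition inv_energy k : R :=
  inv_rho k / (2 * inv_beta k) / (gamma k - 1)
  + (2 * inv_rho k)^-1 * normsq (inv_rho k *: inv_vel k)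
  + 2^-1 * normsq inv_mag + 2^-1 * inv_psi ^+ 2.

End Inversion.

Section Recovery.
Variable u : state R N.
Hypothesis hadm : admissible gamma u.
Local Notation w := (entropy_vars gamma u).

Lemma recover_beta k : inv_beta w k = beta gamma u k.
Proof. by rewrite /inv_beta entropy_vars_energy//; field. Qed.

Lemma recover_vel k : inv_vel w k = vel u k.
Proof.
rewrite /inv_vel recover_beta entropy_vars_mom// scalerA mulVf ?scale1r//.
by rewrite lt0r_neq0// mulr_gt0// beta_gt0.
Qed.

Lemma recover_rho k : inv_rho w k = rho u k.
Proof.
have g0 : gamma k - 1 != 0 by rewrite subr_eq0 gt_eqF.
have g1 : 1 - gamma k != 0 by rewrite subr_eq0 lt_eqF.
have [rho_gt0 _] := hadm k.
rewrite /inv_rho /inv_spec_entropy recover_beta recover_vel entropy_vars_rho//.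
rewrite -[RHS]lnK ?posrE// spec_entropy_beta//; congr expR.
by field; rewrite g0 g1.
Qed.

Lemma recover_beta_plus : \sum_k inv_beta w k = beta_plus gamma u.
Proof. by apply: eq_bigr => k _; rewrite recover_beta. Qed.

Hypothesis hN : (0 < N)%N.

Lemma beta_plus_neq0 : 2 * beta_plus gamma u != 0.
Proof.
rewrite lt0r_neq0// mulr_gt0// /beta_plus (bigD1 (Ordinal hN))//=.
by rewrite ltr_wpDr ?beta_gt0// sumr_ge0// => k _; rewrite ltW// beta_gt0.
Qed.

Lemma recover_mag : inv_mag w = mag u.
Proof.
rewrite /inv_mag recover_beta_plus entropy_vars_mag// scalerA.
by rewrite mulVf ?scale1r// beta_plus_neq0.
Qed.

Lemma recover_psi : inv_psi w = psi u.
Proof.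
rewrite /inv_psi recover_beta_plus entropy_vars_psi// mulrA.
by rewrite mulVf ?mul1r// beta_plus_neq0.
Qed.

Lemma recover_mom k : inv_rho w k *: inv_vel w k = mom u k.
Proof. by rewrite recover_rho recover_vel mom_vel. Qed.

Lemma recover_energy k : inv_energy w k = energy u k.
Proof.
rewrite /inv_energy recover_mom recover_rho recover_beta recover_mag.
by rewrite recover_psi -pressure_beta// -energy_pressure.
Qed.

End Recovery.

(** Each component of an admissible state is a function of its entropy
    variables. *)
Lemma entropy_vars_inj : (0 < N)%N ->
  {in admissible gamma &, injective (entropy_vars gamma)}.
Proof.
move=> hN u u' /set_mem hu /set_mem hu' ww'.
have transfer T (f g : state R N -> T) :
    (forall v, admissible gamma v -> g (entropy_vars gamma v) = f v) ->
    f u = f u'.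
  move=> gf; exact: etrans (esym (gf u hu)) (etrans (congr1 g ww') (gf u' hu')).
apply: state_ext => [k|k|k||].
- exact: (transfer _ (fun v => rho v k) (fun w => inv_rho w k)
           (fun v hv => recover_rho hv k)).
- exact: (transfer _ (fun v => mom v k) (fun w => inv_rho w k *: inv_vel w k)
           (fun v hv => recover_mom hv k)).
- exact: (transfer _ (fun v => energy v k) (fun w => inv_energy w k)
           (fun v hv => recover_energy hv hN k)).
- exact: (transfer _ (fun v => mag v) inv_mag
           (fun v hv => recover_mag hv hN)).
- exact: (transfer _ (fun v => psi v) inv_psi
           (fun v hv => recover_psi hv hN)).
Qed.

End EntropyVariables.

(** * Entropy balance of a smooth solution *)

(** The pointwise algebra behind the pressure equation.  Here dv i j stands for
    the derivative of v_j along x_i, dB i for that of B_i along x_i, cvm for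
    curl (v^+ x B), c for the cleaning speed and adv for v^+ . grad psi.  On the
    left is (gamma - 1) (E_t - v . m_t + |v|^2 rho_t / 2 - B . B_t - psi psi_t)
    with the time derivatives replaced by the equations of the system: slip,
    cur, cvm and adv occur twice with opposite signs, and the terms in c cancel
    by the product rule for div (psi B). *)
Lemma internal_energy_identity (R : realFieldType)
    (v slip cur cvm B dpsi dB drho dp : 'I_3 -> R) (dv : 'I_3 -> 'I_3 -> R)
    (rho p psi g c adv : R) : g - 1 != 0 ->
  (g - 1) *
   (- \sum_i ((2^-1 * drho i * (\sum_j v j * v j)
              + rho * (\sum_j v j * dv i j) + g / (g - 1) * dp i) * v i
             + (2^-1 * rho * (\sum_j v j * v j) + g / (g - 1) * p) * dv i i
             + c * (dpsi i * B i + psi * dB i))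
    - \sum_i v i * slip i + \sum_i v i * cur i + \sum_i B i * cvm i
    - psi * adv
    - \sum_i v i * (- \sum_j (drho j * (v i * v j)
                     + rho * (dv j i * v j + v i * dv j j))
                   - dp i - slip i + cur i)
    + 2^-1 * (- \sum_i (drho i * v i + rho * dv i i)) * (\sum_j v j * v j)
    - \sum_i B i * (- (c * dpsi i) + cvm i)
    - psi * (- (c * \sum_i dB i) - adv)) =
  - \sum_i (v i * dp i + g * p * dv i i).
Proof.
move=> g0; rewrite !big_ord_recl !big_ord0.
by field.
Qed.

Section EntropyBalance.
Variables (R : realType) (N : nat) (gamma r : 'I_N -> R).
Hypothesis hgamma : forall k, 1 < gamma k.
Variables (ch : R -> R) (pe : R * 'rV[R]_3 -> R).
Variables (U : R * 'rV[R]_3 -> state R N) (z : R * 'rV[R]_3).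
Hypothesis hU : differentiable U z.
Hypothesis hadm : admissible gamma (U z).
Implicit Types (k : 'I_N) (i j : 'I_3) (h : R * 'rV[R]_3).

Let hdU h : is_derive z h U ('D_h U z).
Proof. exact/derivableP/diff_derivable. Qed.

Let rho_neq0 k : rho (U z) k != 0.
Proof. by have [/lt0r_neq0] := hadm k. Qed.

Let gamma_neq0 k : gamma k - 1 != 0.
Proof. by rewrite subr_eq0 gt_eqF. Qed.

Local Notation e i := ((0, delta_mx 0 i) : R * 'rV[R]_3).

Local Notation rhoz k := (rho (U z) k).
Local Notation velz k i := (vel (U z) k 0 i).
Local Notation pz k := (pressure gamma (U z) k).
Local Notation d_rho h k := ('D_h (fun y => rho (U y) k) z).
Local Notation d_vel h k i := ('D_h (fun y => vel (U y) k 0 i) z).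
Local Notation d_p h k := ('D_h (fun y => pressure gamma (U y) k) z).
Local Notation d_psi h := ('D_h (fun y => psi (U y)) z).
Local Notation d_mag h i := ('D_h (fun y => mag (U y) 0 i) z).

Let der_rho h k : is_derive z h (fun y => rho (U y) k) (d_rho h k).
Proof. by have [hd _] := is_derive_rho (hdU h) k; exact: derivableP. Qed.

Let der_vel h k i : is_derive z h (fun y => vel (U y) k 0 i) (d_vel h k i).
Proof.
have [hd _] := is_derive_coord 0 i (is_derive_vel (hdU h) (rho_neq0 k)).
exact: derivableP.
Qed.

Let der_p h k : is_derive z h (fun y => pressure gamma (U y) k) (d_p h k).
Proof.
have [hd _] := is_derive_pressure gamma (hdU h) (rho_neq0 k).
exact: derivableP.
Qed.

Let der_psi h : is_derive z h (fun y => psi (U y)) (d_psi h).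
Proof. by have [hd _] := is_derive_psi (hdU h); exact: derivableP. Qed.

Let der_mag h i : is_derive z h (fun y => mag (U y) 0 i) (d_mag h i).
Proof.
have [hd _] := is_derive_coord 0 i (is_derive_mag (hdU h)).
exact: derivableP.
Qed.

Let der_ch i : is_derive z (e i) (fun y => ch y.1) 0.
Proof.
by apply: is_derive_frozen => t; rewrite /= [t *: 0]mulr0 add0r.
Qed.

(** At points where rho vanishes v = 0 by convention and m = rho v may fail, so
    this is not the product rule for two equal functions: it is the quotient
    rule for v at z, where rho > 0, solved for the derivative of m. *)
Let der_mom h k i : is_derive z h (fun y => mom (U y) k 0 i)
  (d_rho h k * velz k i + rhoz k * d_vel h k i).
Proof.
have der_U := hdU h; have [_ ->] := is_derive_rho der_U k.
have [_ ->] := is_derive_coord 0 i (is_derive_vel der_U (rho_neq0 k)).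
apply: is_derive_eq (is_derive_coord 0 i (is_derive_mom der_U k)) _.
by rewrite !mxE; field.
Qed.

Let pressure_diffE h k : pressure_diff gamma (U z) ('D_h U z) k = d_p h k.
Proof. by have [_ ->] := is_derive_pressure gamma (hdU h) (rho_neq0 k). Qed.

Let row_addE (a b : 'rV[R]_3) i : (a + b) 0 i = a 0 i + b 0 i.
Proof. by rewrite mxE. Qed.

Let row_oppE (a : 'rV[R]_3) i : (- a) 0 i = - a 0 i.
Proof. by rewrite mxE. Qed.

Let row_scaleE c (a : 'rV[R]_3) i : (c *: a) 0 i = c * a 0 i.
Proof. by rewrite mxE. Qed.

(** The next five lemmas solve the equations of the system for the time
    derivatives, with the fluxes differentiated by the product rule in terms of
    the derivatives of rho, v, p, B and psi. *)
Lemma mass_balance k : mass_eq U z k ->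
  dt (fun y => rho (U y) k) z =
  - \sum_i (d_rho (e i) k * velz k i + rhoz k * d_vel (e i) k i).
Proof.
move=> /eqP; rewrite addr_eq0 => /eqP->; congr (- _).
by apply: eq_bigr => i _; have [_] := der_mom (e i) k i.
Qed.

Lemma momentum_balance k i : momentum_eq gamma r pe U z k ->
  ('D_(1, 0) (fun y => mom (U y) k) z) 0 i =
  - \sum_j (d_rho (e j) k * (velz k i * velz k j)
      + rhoz k * (d_vel (e j) k i * velz k j + velz k i * d_vel (e j) k j))
  - d_p (e i) k - slip_force r U z k 0 i + current_force r pe U z k 0 i.
Proof.
move=> /(congr1 (fun F : 'rV[R]_3 => F 0 i)); rewrite !row_addE row_oppE.
rewrite [dvg_mx _ _ _ _]mxE [RHS]mxE => hmom.
have flux j : dx j (fun y => (rho (U y) k *: ((vel (U y) k)^T *m vel (U y) k)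
                     + (pressure gamma (U y) k)%:M) i j) z =
    d_rho (e j) k * (velz k i * velz k j)
    + rhoz k * (d_vel (e j) k i * velz k j + velz k i * d_vel (e j) k j)
    + d_p (e j) k * (j == i)%:R.
  rewrite /dx (_ : (fun y => _) = fun y =>
      rho (U y) k * (vel (U y) k 0 i * vel (U y) k 0 j)
      + (j == i)%:R * pressure gamma (U y) k); last first.
    apply/funext => y; rewrite !mxE big_ord1 !mxE eq_sym.
    by congr (_ + _); rewrite mulrC mulr_natr.
  have [_ ->] := is_derive_fun_add
    (is_derive_fun_mul (der_rho (e j) k)
      (is_derive_fun_mul (der_vel (e j) k i) (der_vel (e j) k j)))
    (is_derive_fun_scale (j == i)%:R (der_p (e j) k)).
  by rewrite [(j == i)%:R * _]mulrC.
move: hmom; under eq_bigr do rewrite flux.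
rewrite big_split /= (sum_pick _ (x0 := i))//.
rewrite /dt; set S := \sum_j _ => hmom.
by apply/eqP; rewrite -subr_eq0 -[X in _ == X]hmom; apply/eqP; ring.
Qed.

Lemma energy_balance k : energy_eq gamma r ch pe U z k ->
  dt (fun y => energy (U y) k) z =
  - \sum_i ((2^-1 * d_rho (e i) k * normsq (vel (U z) k)
             + rhoz k * (\sum_j velz k j * d_vel (e i) k j)
             + gamma k / (gamma k - 1) * d_p (e i) k) * velz k i
            + (2^-1 * rhoz k * normsq (vel (U z) k)
             + gamma k / (gamma k - 1) * pz k) * d_vel (e i) k i
            + ch z.1 * (d_psi (e i) * mag (U z) 0 i
                        + psi (U z) * d_mag (e i) i))
  - dot (vel (U z) k) (slip_force r U z k)
  + dot (vel (U z) k) (current_force r pe U z k)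
  + dot (mag (U z)) (curl_vplus_mag r U z)
  - psi (U z) * dot (vplus r (U z)) (grad (@psi R N \o U) z).
Proof.
rewrite /energy_eq /dvg => henergy.
have flux i : dx i (fun y => ((hydro_energy gamma (U y) k
        + pressure gamma (U y) k) *: vel (U y) k
        + (ch y.1 * psi (U y)) *: mag (U y)) 0 i) z =
    (2^-1 * d_rho (e i) k * normsq (vel (U z) k)
     + rhoz k * (\sum_j velz k j * d_vel (e i) k j)
     + gamma k / (gamma k - 1) * d_p (e i) k) * velz k i
    + (2^-1 * rhoz k * normsq (vel (U z) k)
     + gamma k / (gamma k - 1) * pz k) * d_vel (e i) k i
    + ch z.1 * (d_psi (e i) * mag (U z) 0 i + psi (U z) * d_mag (e i) i).
  rewrite /dx (_ : (fun y => _) = fun y =>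
      (2^-1 * (rho (U y) k * \sum_j vel (U y) k 0 j * vel (U y) k 0 j)
       + gamma k / (gamma k - 1) * pressure gamma (U y) k) * vel (U y) k 0 i
      + ch y.1 * psi (U y) * mag (U y) 0 i); last first.
    apply/funext => y; rewrite row_addE !row_scaleE; congr (_ * _ + _).
    by rewrite /hydro_energy /normsq /dot; field.
  have [_ ->] := is_derive_fun_add
    (is_derive_fun_mul
      (is_derive_fun_add
        (is_derive_fun_scale 2^-1 (is_derive_fun_mul (der_rho (e i) k)
          (is_derive_fun_sum (fun j => is_derive_fun_mul
             (der_vel (e i) k j) (der_vel (e i) k j)))))
        (is_derive_fun_scale (gamma k / (gamma k - 1)) (der_p (e i) k)))
      (der_vel (e i) k i))
    (is_derive_fun_mul (is_derive_fun_mul (der_ch i) (der_psi (e i)))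
      (der_mag (e i) i)).
  rewrite (_ : \sum_j (_ + _) = 2 * \sum_j velz k j * d_vel (e i) k j);
    last first.
    by rewrite mulr_sumr; apply: eq_bigr => j _; ring.
  by rewrite /normsq /dot; field.
move: henergy; under eq_bigr do rewrite flux.
set S := \sum_i _ => henergy.
by apply/eqP; rewrite -subr_eq0 -[X in _ == X]henergy; apply/eqP; ring.
Qed.

Lemma induction_balance i : induction_eq r ch U z ->
  ('D_(1, 0) (fun y => mag (U y)) z) 0 i =
  - (ch z.1 * d_psi (e i)) + curl_vplus_mag r U z 0 i.
Proof.
move=> /(congr1 (fun F : 'rV[R]_3 => F 0 i)); rewrite !row_addE row_oppE.
rewrite [grad _ _ _ _]mxE [RHS]mxE /dx.
have [_ ->] := is_derive_fun_mul (der_ch i) (der_psi (e i)).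
rewrite /dt => hind.
by apply/eqP; rewrite -subr_eq0 -[X in _ == X]hind; apply/eqP; ring.
Qed.

Lemma cleaning_balance : cleaning_eq r ch U z ->
  dt (fun y => psi (U y)) z =
  - (ch z.1 * \sum_i d_mag (e i) i)
  - dot (vplus r (U z)) (grad (@psi R N \o U) z).
Proof.
rewrite /cleaning_eq /dvg => hclean.
have flux i : dx i (fun y => (ch y.1 *: mag (U y)) 0 i) z =
    ch z.1 * d_mag (e i) i.
  rewrite /dx (_ : (fun y => _) = fun y => ch y.1 * mag (U y) 0 i); last first.
    by apply/funext => y; rewrite mxE.
  have [_ ->] := is_derive_fun_mul (der_ch i) (der_mag (e i) i).
  by rewrite mul0r add0r.
move: hclean; under eq_bigr do rewrite flux.
rewrite -mulr_sumr => hclean.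
by apply/eqP; rewrite -subr_eq0 -[X in _ == X]hclean; apply/eqP; ring.
Qed.

(** The magnetic field and psi have disappeared: each species obeys the
    pressure equation of an ideal gas. *)
Lemma pressure_balance k :
  mass_eq U z k -> momentum_eq gamma r pe U z k ->
  energy_eq gamma r ch pe U z k -> induction_eq r ch U z ->
  cleaning_eq r ch U z ->
  d_p (1, 0) k =
  - \sum_i (velz k i * d_p (e i) k + gamma k * pz k * d_vel (e i) k i).
Proof.
move=> hmass hmom henergy hind hclean; have der_U := hdU (1, 0).
rewrite -pressure_diffE /pressure_diff /normsq /dot.
have [_ <-] := is_derive_rho der_U k.
have := mass_balance hmass; rewrite /dt => ->.
have [_ <-] := is_derive_energy der_U k.
have := energy_balance henergy; rewrite /dt => ->.
have [_ <-] := is_derive_psi der_U.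
have := cleaning_balance hclean; rewrite /dt => ->.
under [X in _ * (_ - X + _ - _ - _)]eq_bigr => i _.
  have [_ <-] := is_derive_mom der_U k; rewrite momentum_balance//.
  over.
under [X in _ * (_ - _ + _ - X - _)]eq_bigr => i _.
  have [_ <-] := is_derive_mag der_U; rewrite induction_balance//.
  over.
exact: internal_energy_identity.
Qed.

Let der_S h k : is_derive z h (fun y => species_entropy gamma (U y) k)
  ((gamma k - spec_entropy gamma (U z) k) / (gamma k - 1) * d_rho h k
   - 2 * beta gamma (U z) k / (gamma k - 1) * d_p h k).
Proof.
have [rho_gt0 p_gt0] := hadm k.
have := is_derive_species_entropy (hdU h) rho_gt0 p_gt0 (hgamma k).
by rewrite pressure_diffE; have [_ <-] := is_derive_rho (hdU h) k.
Qed.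

Let der_Sv h k i :=
  is_derive_fun_mul (der_S h k) (der_vel h k i).

(** S is a function of rho and p, which satisfy rho_t + v . grad rho =
    - rho div v and p_t + v . grad p = - gamma p div v; the coefficient of div v
    in S_t + div (S v) is
    - rho (gamma - s) / (gamma - 1) + 2 beta gamma p / (gamma - 1) + S = 0. *)
Lemma species_entropy_balance k :
  mass_eq U z k -> momentum_eq gamma r pe U z k ->
  energy_eq gamma r ch pe U z k -> induction_eq r ch U z ->
  cleaning_eq r ch U z ->
  'D_(1, 0) (fun y => species_entropy gamma (U y) k) z
  + \sum_i 'D_(e i) (fun y => species_entropy gamma (U y) k * vel (U y) k 0 i) z
  = 0.
Proof.
move=> hmass hmom henergy hind hclean.
have [_ ->] := der_S (1, 0) k; rewrite pressure_balance//.
have := mass_balance hmass; rewrite /dt => ->.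
rewrite !mulrN opprK !mulr_sumr -sumrN -!big_split.
apply: big1 => i _ /=; have [_ ->] := der_Sv (e i) k i.
rewrite /species_entropy /beta; set s := spec_entropy _ _ _.
have [_ /lt0r_neq0 p0] := hadm k.
by field; rewrite gamma_neq0 p0.
Qed.

Lemma entropy_balance :
  [/\ forall k, mass_eq U z k, forall k, momentum_eq gamma r pe U z k,
      forall k, energy_eq gamma r ch pe U z k, induction_eq r ch U z
    & cleaning_eq r ch U z] ->
  dt (entropy gamma \o U) z + dvg (entropy_flux gamma \o U) z = 0.
Proof.
move=> [hmass hmom henergy hind hclean].
have [_ St] := is_derive_fun_sum (der_S (1, 0)).
have flux i : dx i (fun y => (entropy_flux gamma \o U) y 0 i) z =
    \sum_k
      'D_(e i) (fun y => species_entropy gamma (U y) k * vel (U y) k 0 i) z.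
  rewrite /dx (_ : (fun y => _) = fun y =>
      \sum_k species_entropy gamma (U y) k * vel (U y) k 0 i); last first.
    apply/funext => y; rewrite /= summxE.
    by apply: eq_bigr => k _; rewrite row_scaleE.
  have [_ ->] := is_derive_fun_sum (fun k => der_Sv (e i) k i).
  by apply: eq_bigr => k _; have [_ ->] := der_Sv (e i) k i.
rewrite /dt [X in X + _]St /dvg; under [X in _ + X]eq_bigr do rewrite flux.
rewrite exchange_big -big_split; apply: big1 => k _ /=.
have [_ <-] := der_S (1, 0) k; exact: species_entropy_balance.
Qed.

End EntropyBalance.

Theorem mainTheorem3 (R : realType) (N : nat) (hN : (0 < N)%N)
    (gamma r : 'I_N -> R) (hgamma : forall k, 1 < gamma k) :
  [/\ forall u : state R N, admissible gamma u ->
        let w := entropy_vars gamma u in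
        [/\ differentiable (entropy gamma) u,
            forall k,
              [/\ rho w k = (gamma k - spec_entropy gamma u k) / (gamma k - 1)
                            - beta gamma u k * normsq (vel u k),
                  mom w k = (2 * beta gamma u k) *: vel u k
                & energy w k = - 2 * beta gamma u k],
            mag w = (2 * beta_plus gamma u) *: mag u
          & psi w = 2 * beta_plus gamma u * psi u],
      set_bij (admissible gamma)
        (entropy_vars gamma @` admissible gamma) (entropy_vars gamma)
    & forall (ch : R -> R) (D : set (R * 'rV[R]_3))
        (pe : R * 'rV[R]_3 -> R) (U : R * 'rV[R]_3 -> state R N),
        open D ->
        C1_on D pe ->
        C1_on D U ->
        (forall z, D z -> admissible gamma (U z)) ->
        (forall z, D z -> nee r (U z) != 0) ->
        multi_ion_glm_mhd gamma r ch pe U D ->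
        forall z, D z ->
          dt (entropy gamma \o U) z + dvg (entropy_flux gamma \o U) z = 0].
Proof.
split.
- move=> u hadm w; split.
  + exact: entropy_diff.
  + move=> k; split.
    * exact: entropy_vars_rho.
    * exact: entropy_vars_mom.
    * exact: entropy_vars_energy.
  + exact: entropy_vars_mag.
  + exact: entropy_vars_psi.
- exact/inj_bij/entropy_vars_inj.
- move=> ch D pe U _ _ C1U hadm _ hsol z Dz.
  apply: entropy_balance (hsol z Dz) => //.
    by have [] := C1U z Dz.
  exact: hadm.
Qed.
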